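(* For a nonsingular $3\times 3$ real matrix $A=(a_\alpha^\beta)_{\alpha,\beta=1,2,3}$ (lower index = row, upper index = column) with inverse $B=(b_\alpha^\beta)$, let $(x^1,x^2,x^3,y_4,y_5,y_6)$ be the standard linear coordinates on $\mathbb{R}^6$ and define linear functions $x^4,x^5,x^6,y_1,y_2,y_3$ on $\mathbb{R}^6$ by $$x^{3+\alpha}=\sum_{\beta=1}^3 a_\beta^\alpha x^\beta,\qquad y_{3+\alpha}=-\sum_{\beta=1}^3 b_\alpha^\beta y_\beta\qquad(\alpha=1,2,3),$$ the second relation being equivalent to $y_\alpha=-\sum_{\beta} a_\alpha^\beta y_{3+\beta}$. Let $W_A$ be the collection of the six foliations $X_\xi$ of $\mathbb{R}^6$ given by $dx^\xi=0,\ dy_\xi=0$, $\xi=1,\dots,6$. Then the $W_A$ form a $9$-parameter family (parametrized by the nine entries of a generic matrix $A$) of parallelizable, not almost Grassmannizable webs $W(6,3,2)$ of maximum $2$-rank. That is, there is a nonzero real polynomial $P$ in the nine entries of $A$ such that for every nonsingular $A$ with $P(A)\neq0$, $W_A$ is a web $W(6,3,2)$ which is parallelizable, is not almost Grassmannizable, and has maximum $2$-rank (equal to $1$).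
   Context: A $6$-web $W(6,3,2)$ of codimension two on an open domain $D$ of a $6$-dimensional differentiable manifold is given by six foliations $X_1,\dots,X_6$ of $D$ of codimension two such that at each point of $D$ the six tangent $4$-planes to the leaves are in general position. General position means: if the tangent $4$-plane of the $\xi$-th leaf is the common kernel of two linearly independent $1$-forms $\omega_\xi^1,\omega_\xi^2$, then for any three distinct indices $\xi,\eta,\zeta$ the six forms $\omega_\xi^i,\omega_\eta^i,\omega_\zeta^i$ ($i=1,2$) are linearly independent. Two webs $W(6,3,2)$ and $\widetilde W(6,3,2)$ are equivalent if there is a local diffeomorphism of their domains carrying the foliations of one into the foliations of the other. A web formed by six foliations of parallel $4$-planes in an affine space $\mathbb{A}^6$, with the $4$-planes of different foliations in general position, is called parallel; a web equivalent to a parallel web is called parallelizable. Segre cone of a $4$-subweb: for $a\in\{4,5,6\}$, consider the $4$-subweb $[a,1,2,3]$ formed by $X_1,X_2,X_3,X_a$. At a point $p$ one can choose bases $\omega_\xi^1,\omega_\xi^2$ of the annihilators of the tangent $4$-planes of the leaves ($\xi=1,2,3,a$) so that $-\omega_a^i=\omega_1^i+\omega_2^i+\omega_3^i$, $i=1,2$. The Segre cone at $p$ defined by $[a,1,2,3]$ is the set of tangent vectors $v$ for which the $3\times2$ matrix $(\omega_\alpha^i(v))_{\alpha=1,2,3;\,i=1,2}$ has rank at most $1$; this does not depend on the choices. An almost Grassmann structure on a $6$-manifold is a smooth field of such Segre cones (cones over the Segre variety $\mathbb{P}^1\times\mathbb{P}^2\subset\mathbb{P}^5$) in its tangent spaces,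 so each subweb $[a,1,2,3]$ defines one. A web $W(6,3,2)$ is an almost Grassmann web if the three almost Grassmann structures defined by $[4,1,2,3]$, $[5,1,2,3]$, $[6,1,2,3]$ coincide. A web is almost Grassmannizable if it is equivalent to an almost Grassmann web. $2$-rank: suppose the leaves of the $\xi$-th foliation are the level sets $u_\xi^1=\mathrm{const},\,u_\xi^2=\mathrm{const}$ of functions $u_\xi^i$. An abelian $2$-equation is an exterior equation $\sum_{\xi=1}^6 f_\xi(u_\xi^1,u_\xi^2)\,du_\xi^1\wedge du_\xi^2=0$, where each $f_\xi$ is a function of $u_\xi^1,u_\xi^2$ only (so it is constant on the leaves of the $\xi$-th foliation). The $2$-rank of the web is the maximum number of linearly independent (over $\mathbb{R}$) abelian $2$-equations it admits. By a known result of Chern and Griffiths the $2$-rank of any web $W(6,3,2)$ is at most $1$; the web is of maximum $2$-rank if its $2$-rank equals $1$. *)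

(* Defs.v *)
From HB Require Import structures.
From mathcomp Require Import all_boot all_order all_algebra.
From mathcomp Require Import all_classical all_reals all_analysis.
From mathcomp Require mpoly.
(* The notations of multinomials clash with those of MathComp-Analysis; only
   its canonical structures are needed. *)
Import -(notations) mpoly.

Set Implicit Arguments.
Unset Strict Implicit.
Unset Printing Implicit Defensive.

Import Order.TTheory GRing.Theory Num.Theory.
Import numFieldNormedType.Exports.

Local Open Scope classical_set_scope.
Local Open Scope ring_scope.

(* C^k and C^oo maps on an open subset D of R^n, through iterated partial
   derivatives. *)
Fixpoint Ck (R : realType) (n : nat) (W : normedModType R) (k : nat)
    (D : set 'rV[R]_n) (f : 'rV[R]_n -> W) : Prop :=
  match k with
  | 0 => forall x, D x -> {for x, continuous f}
  | k'.+1 => (forall x, D x -> differentiable f x) /\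
             forall i : 'I_n, Ck k' D (fun x => 'D_(delta_mx 0 i) f x)
  end.

Definition smooth_on (R : realType) (n : nat) (W : normedModType R)
    (D : set 'rV[R]_n) (f : 'rV[R]_n -> W) : Prop :=
  forall k, Ck k D f.

Record chart (R : realType) (n : nat) (M : topologicalType) := Chart {
  cdom : set M;
  cmap : M -> 'rV[R]_n;
  cinv : 'rV[R]_n -> M;
  cdom_open : open cdom;
  cimage_open : open (cmap @` cdom);
  cmapK : forall p, cdom p -> cinv (cmap p) = p;
  cmap_continuous : forall p, cdom p -> {for p, continuous cmap};
  cinv_continuous : forall x, (cmap @` cdom) x -> {for x, continuous cinv} }.

Record manifold (R : realType) (n : nat) := Manifold {
  carrier :> topologicalType;
  manifold_hausdorff : hausdorff_space carrier;
  manifold_second_countable : @second_countable carrier;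
  atlas : set (chart R n carrier);
  atlas_cover : forall p, exists2 c, atlas c & cdom c p;
  atlas_smooth : forall c c', atlas c -> atlas c' ->
    smooth_on (cmap c @` (cdom c `&` cdom c')) (cmap c' \o cinv c) }.
Arguments atlas {R n} m _.

Definition chart_at (R : realType) (n : nat) (M : manifold R n) (p : M)
    (c : chart R n M) : Prop :=
  atlas M c /\ cdom c p.

Definition smooth_fun (R : realType) (n m : nat) (M : manifold R n)
    (U : set M) (u : M -> 'rV[R]_m) : Prop :=
  forall c, atlas M c ->
    smooth_on (cmap c @` (cdom c `&` U)) (u \o cinv c).

Definition smooth_map (R : realType) (n n' : nat) (M : manifold R n)
    (N : manifold R n') (U : set M) (phi : M -> N) : Prop :=
  (forall p, U p -> {for p, continuous phi}) /\
  forall c c', atlas M c -> atlas N c' ->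
    smooth_on (cmap c @` (cdom c `&` U `&` phi @^-1` cdom c'))
      (cmap c' \o phi \o cinv c).

(* Column i is the differential at p of the i-th component of u, read in the
   chart c; a tangent vector at p read in c is a row vector v, and
   v *m jac c u p is the value of that differential on v. *)
Definition jac (R : realType) (n m : nat) (M : manifold R n)
    (c : chart R n M) (u : M -> 'rV[R]_m) (p : M) : 'M[R]_(n, m) :=
  jacobian (u \o cinv c) (cmap c p).

Definition submersion2 (R : realType) (n : nat) (M : manifold R n)
    (U : set M) (u : M -> 'rV[R]_2) : Prop :=
  smooth_fun U u /\
  forall p c, U p -> chart_at p c -> \rank (jac c u p) = 2%N.

Definition same_levels (R : realType) (n : nat) (M : manifold R n) (p : M)
    (u u' : M -> 'rV[R]_2) : Prop :=
  exists2 N, nbhs p N &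
    forall q r, N q -> N r -> (u q = u r <-> u' q = u' r).

(* A foliation of codimension two is given by a family of local first
   integrals (U, u): the leaves are obtained by gluing the level sets of the
   submersions u : U -> R^2. *)
Definition foliation_data (R : realType) (M : manifold R 6) :=
  set (set M * (M -> 'rV[R]_2)).

Definition is_foliation (R : realType) (M : manifold R 6) (D : set M)
    (F : foliation_data M) : Prop :=
  [/\ forall U u, F (U, u) -> [/\ open U, U `<=` D & submersion2 U u],
      forall p, D p -> exists U u, F (U, u) /\ U p
    & forall U u U' u' p, F (U, u) -> F (U', u') -> U p -> U' p ->
        same_levels p u u'].

Definition tangent_plane (R : realType) (M : manifold R 6)
    (F : foliation_data M) (c : chart R 6 M) (p : M) : set 'rV[R]_6 :=
  [set v : 'rV[R]_6 | exists U u, [/\ F (U, u), U p & v *m jac c u p = 0]].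

(* The two columns of Om are linearly independent 1-forms with common
   kernel T. *)
Definition is_coframe (R : realType) (T : set 'rV[R]_6) (Om : 'M[R]_(6, 2)) :
    Prop :=
  \rank Om = 2%N /\ forall v, T v <-> v *m Om = 0.

Record preweb (R : realType) := Preweb {
  wman : manifold R 6;
  wdom : set wman;
  wfol : 'I_6 -> foliation_data wman }.
Arguments wdom {R} p _.
Arguments wfol {R} p _.

Definition general_position (R : realType) (W : preweb R) (p : wman W) :
    Prop :=
  forall c, chart_at p c ->
  exists Om : 'I_6 -> 'M[R]_(6, 2),
    (forall xi, is_coframe (tangent_plane (wfol W xi) c p) (Om xi)) /\
    forall xi eta zeta, xi != eta -> xi != zeta -> eta != zeta ->
      \rank (row_mx (Om xi) (row_mx (Om eta) (Om zeta))) = 6%N.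

Definition is_web (R : realType) (W : preweb R) : Prop :=
  [/\ open (wdom W),
      forall xi, is_foliation (wdom W) (wfol W xi)
    & forall p, wdom W p -> general_position p].

(* The local diffeomorphism is phi : U -> V with inverse psi; it carries leaves
   of the xi-th foliation to leaves of the xi-th foliation, which is tested on
   local first integrals. *)
Definition equivalent (R : realType) (W W' : preweb R) : Prop :=
  exists (U : set (wman W)) (V : set (wman W'))
         (phi : wman W -> wman W') (psi : wman W' -> wman W),
    [/\ [/\ open U, U !=set0, U `<=` wdom W, open V & V `<=` wdom W'],
        [/\ phi @` U `<=` V, psi @` V `<=` U,
            forall p, U p -> psi (phi p) = p
          & forall q, V q -> phi (psi q) = q],
        smooth_map U phi, smooth_map V psi
      & forall xi p, U p ->
          forall U1 u V1 v, wfol W xi (U1, u) -> wfol W' xi (V1, v) ->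
            U1 p -> V1 (phi p) -> same_levels p u (v \o phi)].

Definition level_web (R : realType) (M : manifold R 6) (D : set M)
    (u : 'I_6 -> M -> 'rV[R]_2) : preweb R :=
  Preweb D (fun xi => [set (D, u xi)]).

Section Euclidean.
Variables (R : realType) (n : nat).
Let V := 'rV[R]_n.

Lemma smooth_cst (W : normedModType R) (D : set V) (a : W) :
  smooth_on D (cst a).
Proof.
move=> k; elim: k a => [|k IHk] a /=; first by move=> x _; exact: cst_continuous.
split=> [x _|i]; first exact: differentiable_cst.
rewrite (_ : (fun _ => _) = cst 0); first exact: IHk.
by apply/funext => x; rewrite derive_cst.
Qed.

Lemma smooth_id (D : set V) : smooth_on D (id : V -> V).
Proof.
case=> [|k] /=; first by move=> x _; exact: cvg_id.
split=> [x _|i]; first exact: ex_diff.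
rewrite (_ : (fun _ => _) = cst (delta_mx 0 i)); first exact: smooth_cst.
by apply/funext => x; rewrite derive_id.
Qed.

Lemma euclidean_second_countable : @second_countable V.
Proof.
pose B (z : 'rV[rat]_n * nat) : set V :=
  (ball (map_mx ratr z.1 : V) (z.2.+1%:R^-1 : R)).
exists (range B).
  by apply: card_le_trans (card_image_le _ _) _; exact: countableP.
split=> [_ [z _ <-]|x U /nbhs_ballP[e /= e0 xU]].
  by apply: ball_open; rewrite invr_gt0.
have e20 : 0 < e / 2 by rewrite divr_gt0.
have [k _ ke] := near_infty_natSinv_lt (PosNum e20).
have /= {}ke := ke k (leqnn k).
pose d : R := k.+1%:R^-1.
have d0 : 0 < d by rewrite invr_gt0.
have q_ (i : 'I_n) : exists q : rat, ratr q \in `]x 0 i - d, x 0 i + d[.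
  by apply: rat_in_itvoo; rewrite ltrD2l gtrN.
pose q : 'rV[rat]_n := \row_i projT1 (cid (q_ i)).
have qx : ball (map_mx ratr q : V) d x.
  split=> // i j; rewrite /ball /= !mxE (ord1 i).
  by case: cid => r; rewrite /= in_itv /= ltr_distl.
exists (B (q, k)); first by split => //; exists (q, k).
move=> y qy; apply: xU; rewrite (splitr e); apply: (@ball_triangle _ _ (map_mx ratr q : V)).
  by apply: ball_sym; apply: le_ball qx; exact: ltW.
by apply: le_ball qy; exact: ltW.
Qed.

Lemma open_image_id : open ((id : V -> V) @` setT).
Proof. by rewrite image_id; exact: openT. Qed.

Definition euclidean_chart : chart R n V :=
  @Chart R n V setT id id openT open_image_id
    (fun p _ => erefl) (fun p _ => cvg_id) (fun p _ => cvg_id).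

Definition euclidean_atlas : set (chart R n V) := [set euclidean_chart].

Lemma euclidean_cover (p : V) : exists2 c, euclidean_atlas c & cdom c p.
Proof. by exists euclidean_chart. Qed.

Lemma euclidean_smooth c c' : euclidean_atlas c -> euclidean_atlas c' ->
  smooth_on (cmap c @` (cdom c `&` cdom c')) (cmap c' \o cinv c).
Proof. by move=> -> ->; exact: smooth_id. Qed.

Definition euclidean : manifold R n :=
  @Manifold R n V (@norm_hausdorff R V) euclidean_second_countable
    euclidean_atlas euclidean_cover euclidean_smooth.
End Euclidean.

(* Six foliations of R^6 by parallel 4-planes x *m L xi = const; these are
   4-planes in general position exactly when this is a web. *)
Definition linear_web (R : realType) (L : 'I_6 -> 'M[R]_(6, 2)) : preweb R :=
  @level_web R (euclidean R 6) setT (fun xi x => x *m L xi).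

Definition parallel (R : realType) (W : preweb R) : Prop :=
  is_web W /\ exists L, W = linear_web L.

Definition parallelizable (R : realType) (W : preweb R) : Prop :=
  exists2 W', parallel W' & equivalent W W'.

(* Indices xi = 1, 2, 3 and xi = 4, 5, 6 (shifted to start from 0) *)
Definition lo (al : 'I_3) : 'I_6 := lshift 3 al.
Definition hi (al : 'I_3) : 'I_6 := rshift 3 al.

(* Read in the chart c; the cone does not depend on the choice of the
   normalized bases Om, Oma, so it is defined by an existential over them. *)
Definition segre_cone (R : realType) (W : preweb R) (a : 'I_6)
    (c : chart R 6 (wman W)) (p : wman W) : set 'rV[R]_6 :=
  [set v : 'rV[R]_6 | exists (Om : 'I_3 -> 'M[R]_(6, 2)) (Oma : 'M[R]_(6, 2)),
    [/\ forall al, is_coframe (tangent_plane (wfol W (lo al)) c p) (Om al),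
        is_coframe (tangent_plane (wfol W a) c p) Oma,
        - Oma = \sum_al Om al
      & (\rank (\matrix_(al < 3, i < 2) (v *m Om al) ord0 i) <= 1)%N]].

Definition almost_grassmann (R : realType) (W : preweb R) : Prop :=
  is_web W /\
  forall p c, wdom W p -> chart_at p c ->
    forall al be, segre_cone (hi al) c p = segre_cone (hi be) c p.

Definition almost_grassmannizable (R : realType) (W : preweb R) : Prop :=
  exists2 W', almost_grassmann W' & equivalent W W'.

Definition wedge (R : realType) (n : nat) (J : 'M[R]_(n, 2)) (v w : 'rV[R]_n) :
    R :=
  (v *m J) 0 0 * (w *m J) 0 1 - (w *m J) 0 0 * (v *m J) 0 1.

(* u xi is a first integral of the xi-th foliation on the whole domain, so the
   leaves are the level sets of u xi. *)
Definition first_integrals (R : realType) (W : preweb R)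
    (u : 'I_6 -> wman W -> 'rV[R]_2) : Prop :=
  forall xi, wfol W xi (wdom W, u xi).

(* The 2-form sum_xi f_xi(u_xi) du_xi^1 /\ du_xi^2 vanishes on the domain. No
   regularity is imposed on the f_xi. *)
Definition abelian_equation (R : realType) (W : preweb R)
    (u : 'I_6 -> wman W -> 'rV[R]_2) (f : 'I_6 -> 'rV[R]_2 -> R) : Prop :=
  forall p c, wdom W p -> chart_at p c ->
    forall v w, \sum_xi f xi (u xi p) * wedge (jac c (u xi) p) v w = 0.

(* Equations are compared through the functions f_xi(u_xi) on the domain:
   the values of f_xi off the range of u_xi are irrelevant. *)
Definition independent_equations (R : realType) (W : preweb R)
    (u : 'I_6 -> wman W -> 'rV[R]_2) (r : nat)
    (f : 'I_r -> 'I_6 -> 'rV[R]_2 -> R) : Prop :=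
  forall a : 'I_r -> R,
    (forall xi p, wdom W p -> \sum_k a k * f k xi (u xi p) = 0) ->
    forall k, a k = 0.

Definition admits_equations (R : realType) (W : preweb R)
    (u : 'I_6 -> wman W -> 'rV[R]_2) (r : nat) : Prop :=
  exists2 f : 'I_r -> 'I_6 -> 'rV[R]_2 -> R,
    (forall k, abelian_equation u (f k)) & independent_equations u f.

Definition two_rank (R : realType) (W : preweb R) (r : nat) : Prop :=
  exists u : 'I_6 -> wman W -> 'rV[R]_2,
    [/\ first_integrals u, admits_equations u r
      & forall s, admits_equations u s -> (s <= r)%N].

Definition maximum_two_rank (R : realType) (W : preweb R) : Prop :=
  two_rank W 1.

(* The coordinates of p are (x^1, x^2, x^3, y_4, y_5, y_6). The entry a_al^be
   is A al be (lower index = row), and y_1, y_2, y_3 are given by the solved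
   relation y_al = - sum_be a_al^be y_(3+be); see ycoord_inverse. *)
Definition xcoord (R : realType) (A : 'M[R]_3) (xi : 'I_6) (p : 'rV[R]_6) : R :=
  match fintype.split (xi : 'I_(3 + 3)) with
  | inl al => p 0 (lo al)
  | inr al => \sum_be A be al * p 0 (lo be)
  end.

Definition ycoord (R : realType) (A : 'M[R]_3) (xi : 'I_6) (p : 'rV[R]_6) : R :=
  match fintype.split (xi : 'I_(3 + 3)) with
  | inl al => - \sum_be A al be * p 0 (hi be)
  | inr al => p 0 (hi al)
  end.

Lemma ycoord_inverse (R : realType) (A : 'M[R]_3) (p : 'rV[R]_6) (al : 'I_3) :
  A \in unitmx ->
  ycoord A (hi al) p = - \sum_be invmx A al be * ycoord A (lo be) p.
Proof.
move=> uA; rewrite /ycoord /hi (unsplitK (inr al)) -/(hi al).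
under eq_bigr => be _ do rewrite /lo (unsplitK (inl be)) mulrN.
rewrite sumrN opprK.
have := congr1 (fun X : 'cV[R]_3 => X al 0)
  (mulKmx uA (\col_be p 0 (hi be) : 'cV[R]_3)).
rewrite !mxE => <-; apply: eq_bigr => be _; congr (_ * _); rewrite !mxE.
by apply: eq_bigr => ga _; rewrite mxE.
Qed.

Definition web_A (R : realType) (A : 'M[R]_3) : preweb R :=
  @level_web R (euclidean R 6) setT
    (fun xi p => \row_(i < 2) (if i == 0 then xcoord A xi p else ycoord A xi p)).

(* Main.v *)
Require Import Defs.
From mathcomp Require Import all_boot all_order all_algebra.
From mathcomp Require Import all_classical all_reals all_analysis.
From mathcomp Require mpoly.
From mathcomp Require Import ring.
Import -(notations) mpoly.
Import Order.TTheory GRing.Theory Num.Theory.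
Import numFieldNormedType.Exports.

Set Implicit Arguments.
Unset Strict Implicit.

Local Open Scope classical_set_scope.
Local Open Scope ring_scope.

(** The web W_A is made of parallel 4-planes: the first integral (x^xi, y_xi)
    is right multiplication by a 6 x 2 matrix [integral_mx A xi], in which x^xi
    is given by the column xi of the 3 x 6 matrix [I | A] and y_xi by the
    column xi of [- A^T | I].

    Web and parallelizability.  Three foliations are in general position
    exactly when the corresponding 3 x 3 minors of [I | A] and of [- A^T | I]
    do not vanish; a web of parallel planes is its own parallel model.

    Maximum 2-rank.  Since [I | A] *m [- A^T | I]^T = - A + A = 0, the sum of
    the six forms dx^xi /\ dy_xi is zero ([sum_wedge]), which is an abelian
    equation.  Conversely, in a relation with coefficients f_xi the coefficient
    of dx^i /\ dy_(3+j) is a_i^j (f_(3+j) - f_i), so that all f_xi take the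
    same value at each point ([relation_constant]).  That common value is a
    function of (x^1, y_1) and also a function of (x^2, y_2); these four
    coordinates are independent, so it is constant and the abelian equations
    form a line ([web_A_two_rank]).

    Almost Grassmann structures.  Suppose that W_A is equivalent to a web W.
    The differential of the equivalence identifies the tangent planes of W at
    some point with those of W_A ([equivalent_tangent]), and the Segre cones
    are determined by the tangent planes.  From
      (x^(3+a), y_(3+a)) = \sum_be (a_be^a x^be, - b_a^be y_be)
    it follows that the cone of the 4-subweb [3+a,1,2,3] consists of the
    vectors for which the 3 x 2 matrix with rows (a_be^a x^be, - b_a^be y_be)
    has rank at most 1 ([segre_coneE], [integral_mx_hi]).  The vector with
    coordinates x^be = 1 / a_be^1 and y_be = - 1 / b_1^be lies on the cone
    a = 1, because all the rows are (1, 1).  It lies on the cone a = 2 only if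
    the rows (a_be^2 / a_be^1, b_2^be / b_1^be) are proportional, and already
    the first two of them are not for a generic A
    ([web_A_not_almost_grassmannizable]).

    Genericity.  All the inequalities used, with the inverse of A replaced by
    its adjugate, are collected in one polynomial [genericity].  It is nonzero
    because it does not vanish at an integer Vandermonde matrix
    ([genericity_witness]). *)

(** * Linear maps between spaces of row vectors *)

Lemma mulmxr_continuous (R : realType) (n m : nat) (L : 'M[R]_(n, m)) :
  continuous (fun x : 'rV[R]_n => x *m L : 'rV[R]_m).
Proof.
move=> x; apply: (@differentiable_continuous R).
rewrite (_ : (fun y => _) = \sum_(i < n) (fun y : 'rV[R]_n => y 0 i *: row i L)).
  apply: differentiable_sum => i; apply: differentiableZl.
  exact: differentiable_coord.
by apply/funext => y; rewrite mulmx_sum_row fct_sumE.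
Qed.

Lemma mulmxr_differentiable (R : realType) (n m : nat) (L : 'M[R]_(n, m)) x :
  differentiable (fun x : 'rV[R]_n => x *m L : 'rV[R]_m) x.
Proof.
exact: (@linear_differentiable _ _ _ (mulmxr L) x (@mulmxr_continuous _ _ _ L)).
Qed.

Lemma derive_mulmxr (R : realType) (n m : nat) (L : 'M[R]_(n, m)) x v :
  'D_v (fun x : 'rV[R]_n => x *m L : 'rV[R]_m) x = v *m L.
Proof.
rewrite deriveE; last exact: mulmxr_differentiable.
by rewrite (@diff_lin _ _ _ (mulmxr L) x (@mulmxr_continuous _ _ _ L)).
Qed.

Lemma jacobian_mulmxr (R : realType) (n m : nat) (L : 'M[R]_(n, m)) x :
  jacobian (fun x : 'rV[R]_n => x *m L : 'rV[R]_m) x = L.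
Proof.
apply/row_matrixP => i; rewrite !rowE -deriveEjacobian ?derive_mulmxr//.
exact: mulmxr_differentiable.
Qed.

Lemma smooth_mulmxr (R : realType) (n m : nat) (L : 'M[R]_(n, m)) D :
  smooth_on D (fun x : 'rV[R]_n => x *m L : 'rV[R]_m).
Proof.
case=> [|k] /=; first by move=> x _; exact: mulmxr_continuous.
split=> [x _|i]; first exact: mulmxr_differentiable.
rewrite (_ : (fun _ => _) = cst (delta_mx 0 i *m L)); first exact: smooth_cst.
by apply/funext => x; rewrite derive_mulmxr.
Qed.

(** * Webs of parallel planes *)

Lemma jac_linear (R : realType) (m : nat) (L : 'M[R]_(6, m)) c p :
  @chart_at R 6 (euclidean R 6) p c -> jac c (fun x : euclidean R 6 => x *m L) p = L.
Proof. by case=> -> _; rewrite /jac /=; exact: jacobian_mulmxr. Qed.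

Lemma tangent_plane_linear (R : realType) (L : 'I_6 -> 'M[R]_(6, 2)) xi c p v :
  @chart_at R 6 (euclidean R 6) p c ->
  tangent_plane (wfol (linear_web L) xi) c p v <-> v *m L xi = 0.
Proof.
move=> cp; split=> [[U [u [[_ ->] _]]]|vL].
  by rewrite (jac_linear (L xi) cp).
by exists setT, (fun x => x *m L xi); rewrite (jac_linear (L xi) cp); split.
Qed.

Definition in_general_position (F : fieldType) (L : 'I_6 -> 'M[F]_(6, 2)) :=
  forall xi eta zeta, xi != eta -> xi != zeta -> eta != zeta ->
    \rank (row_mx (L xi) (row_mx (L eta) (L zeta))) = 6%N.

Lemma mxrank_row_mx_leq (F : fieldType) m n p (A : 'M[F]_(m, n)) (B : 'M[F]_(m, p)) :
  (\rank (row_mx A B) <= \rank A + \rank B)%N.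
Proof.
rewrite -mxrank_tr tr_row_mx -addsmxE -(mxrank_tr A) -(mxrank_tr B).
exact: mxrank_adds_leqif.
Qed.

(** The three blocks of a 6 x 6 invertible matrix have rank at most 2 each and
    ranks that add up to at least 6. *)
Lemma general_position_rank (F : fieldType) (L : 'I_6 -> 'M[F]_(6, 2)) xi :
  in_general_position L -> \rank (L xi) = 2%N.
Proof.
move=> gpL.
have [eta [ze [h1 h2 h3]]] :
    exists eta ze, [/\ xi != eta, xi != ze & eta != ze].
  have [xi2|xi2] := ltnP xi 2.
    exists (@Ordinal 6 2 isT), (@Ordinal 6 3 isT).
    by rewrite -!val_eqE /= !(ltn_eqF (leq_trans xi2 _)).
  exists (@Ordinal 6 0 isT), (@Ordinal 6 1 isT).
  by rewrite -!val_eqE /= !(gtn_eqF (leq_trans _ xi2)).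
have := mxrank_row_mx_leq (L xi) (row_mx (L eta) (L ze)).
rewrite (gpL _ _ _ h1 h2 h3) => le6; apply/eqP; rewrite eqn_leq rank_leq_col /=.
rewrite -(leq_add2r 4); apply: leq_trans le6 _; rewrite leq_add2l.
apply: leq_trans (mxrank_row_mx_leq _ _) _.
exact: leq_add (rank_leq_col _) (rank_leq_col _).
Qed.

Lemma linear_web_is_web (R : realType) (L : 'I_6 -> 'M[R]_(6, 2)) :
  in_general_position L -> is_web (linear_web L).
Proof.
move=> gpL; split; first exact: openT.
- move=> xi; split.
  + move=> _ _ [-> ->]; split; [exact: openT|by []|split].
      by move=> c ->; exact: smooth_mulmxr.
    by move=> p c _ cp; rewrite (jac_linear (L xi) cp) general_position_rank.
  + by move=> p _; exists setT, (fun x => x *m L xi).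
  + move=> _ _ _ _ p [-> ->] [-> ->] _ _; exists setT; first exact: filterT.
    by [].
- move=> p _ c cp; exists L; split=> // xi; split.
    exact: general_position_rank.
  by move=> v; exact: tangent_plane_linear.
Qed.

Lemma equivalent_refl_linear (R : realType) (L : 'I_6 -> 'M[R]_(6, 2)) :
  equivalent (linear_web L) (linear_web L).
Proof.
have smid : @smooth_map R 6 6 (euclidean R 6) (euclidean R 6) setT id.
  split=> [p _|c c' -> ->]; first exact: cvg_id.
  exact: smooth_id.
exists setT, setT, id, id; split => //.
  by split; [exact: openT|exists 0|by []|exact: openT|by []].
move=> xi p _ U1 u V1 v [_ ->] [_ ->] _ _; exists setT => //.
exact: filterT.
Qed.

Lemma linear_web_parallelizable (R : realType) (L : 'I_6 -> 'M[R]_(6, 2)) :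
  in_general_position L -> parallelizable (linear_web L).
Proof.
move=> gpL; exists (linear_web L); last exact: equivalent_refl_linear.
by split; [exact: linear_web_is_web|exists L].
Qed.

(** * Tangent planes under a local equivalence *)

Lemma smooth_on_differentiable (R : realType) n (W : normedModType R)
    (D : set 'rV[R]_n) (f : 'rV[R]_n -> W) x :
  smooth_on D f -> D x -> differentiable f x.
Proof. by move=> /(_ 1%N)[+ _]; apply. Qed.

Lemma jacobian_comp (R : realType) n m k (f : 'rV[R]_n -> 'rV[R]_m)
    (g : 'rV[R]_m -> 'rV[R]_k) x :
  differentiable f x -> differentiable g (f x) ->
  jacobian (g \o f) x = jacobian f x *m jacobian g (f x).
Proof.
move=> df dg; apply/row_matrixP => i; rewrite !rowE mulmxA.
rewrite -deriveEjacobian; last exact: differentiable_comp.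
rewrite deriveE; last exact: differentiable_comp.
by rewrite diff_comp //= -deriveE // -deriveE // !deriveEjacobian.
Qed.

(** The derivative in direction [v] only sees the values on the line through
    [x]; it will be applied to a line contained in a leaf. *)
Lemma derive_eq0_line (R : realType) n (W : normedModType R)
    (f : 'rV[R]_n -> W) x v :
  (\forall t \near (0 : R), f (t *: v + x) = f x) -> 'D_v f x = 0.
Proof.
move=> fcst; rewrite /derive; apply: cvg_lim => //.
have quot0 : {near 0^', (fun=> 0) =1 fun t : R => t^-1 *: (f (t *: v + x) - f x)}.
  rewrite near_withinE; apply: filterS fcst => t /= -> _.
  by rewrite subrr scaler0.
exact: cvg_trans (near_eq_cvg quot0) (cvg_cst 0).
Qed.

Lemma jacobian_left_inverse (R : realType) n (g h : 'rV[R]_n -> 'rV[R]_n) x :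
  differentiable g x -> differentiable h (g x) ->
  (\forall y \near x, h (g y) = y) -> jacobian g x *m jacobian h (g x) = 1%:M.
Proof.
move=> dg dh hg; rewrite -jacobian_comp //; apply/row_matrixP => i.
rewrite !rowE mulmx1 -deriveEjacobian; last exact: differentiable_comp.
by rewrite (near_eq_derive _ hg) derive_id.
Qed.

Lemma eq_kernel_rank (F : fieldType) n m (L K : 'M[F]_(n, m)) :
  (forall w : 'rV_n, w *m L = 0 -> w *m K = 0) -> \rank L = \rank K ->
  forall w : 'rV_n, w *m L = 0 <-> w *m K = 0.
Proof.
move=> LK rLK; have kLK : (kermx L <= kermx K)%MS.
  by apply/row_subP => i; rewrite sub_kermx LK // -row_mul mulmx_ker row0.
have : (kermx K <= kermx L)%MS.
  by rewrite -(geq_leqif (mxrank_leqif_sup kLK)) !mxrank_ker rLK.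
move=> kKL w; split; first exact: LK.
by move=> wK; apply/sub_kermxP; apply: submx_trans kKL; apply/sub_kermxP.
Qed.

(** [J] is the differential of the equivalence at a point [p], invertible by
    the chain rule.  A vector [w] killed by [L xi] is tangent to the leaf
    through [p], which is an affine plane; a first integral of the image
    foliation is constant along the image of the line [p + t w], so [w *m J] is
    killed by its differential.  This inclusion of kernels is an equality since
    both differentials have rank 2. *)
Lemma equivalent_tangent (R : realType) (L : 'I_6 -> 'M[R]_(6, 2)) (W : preweb R) :
  (forall xi, \rank (L xi) = 2%N) -> is_web W -> equivalent (linear_web L) W ->
  exists q c (J : 'M[R]_6),
    [/\ wdom W q, chart_at q c, J \in unitmx &
      forall xi w, tangent_plane (wfol W xi) c q (w *m J) <-> w *m L xi = 0].
Proof.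
move=> rL [_ Wfol _] [U [V [phi [psi]]]].
case=> -[oU [p Up] _ oV VW] [UV VU psiK _] [phic phis] [_ psis] levels.
have Vq : V (phi p) by apply: UV; exists p.
have [c Ac cq] := atlas_cover (phi p).
pose g : 'rV[R]_6 -> 'rV[R]_6 := cmap c \o phi.
pose h : 'rV[R]_6 -> 'rV[R]_6 := psi \o cinv c.
have Ug : nbhs (p : 'rV[R]_6) (U `&` phi @^-1` cdom c).
  apply: filterI; first by apply: open_nbhs_nbhs; split.
  by apply: phic => //; apply: open_nbhs_nbhs; split => //; exact: cdom_open.
have dg : differentiable g p.
  apply: (smooth_on_differentiable (phis (euclidean_chart R 6) c erefl Ac)).
  by exists p.
have dh : differentiable h (g p).
  apply: (smooth_on_differentiable (psis c (euclidean_chart R 6) Ac erefl)).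
  by exists (phi p).
have hg : \forall y \near (p : 'rV[R]_6), h (g y) = y.
  by apply: filterS Ug => y [Uy cy]; rewrite /h /g /= cmapK // psiK.
have [uJ _] := mulmx1_unit (jacobian_left_inverse dg dh hg).
exists (phi p), c, (jacobian g p); split; [exact: VW|by split|exact: uJ|].
move=> xi w.
have ker U1 u : wfol W xi (U1, u) -> U1 (phi p) ->
    w *m jacobian g p *m jac c u (phi p) = 0 <-> w *m L xi = 0.
  move=> Fu U1q; have [_ _ [us ur]] := (let: And3 a _ _ := Wfol xi in a) _ _ Fu.
  have du : differentiable (u \o cinv c) (g p).
    by apply: (smooth_on_differentiable (us c Ac)); exists (phi p).
  rewrite -mulmxA; apply: iff_sym; move: w.
  apply: eq_kernel_rank; last first.
    rewrite rL eqmxMfull ?row_full_unit ?uJ //.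
    by rewrite ur.
  move=> w wL; rewrite /jac -jacobian_comp // -deriveEjacobian; last first.
    exact: differentiable_comp.
  apply: derive_eq0_line.
  (* Near p, a point y of the leaf of p is mapped into the leaf of phi p. *)
  have [N Np NL] := levels xi p Up setT _ U1 u (erefl _) Fu I U1q.
  have cst_leaf : \forall y \near (p : 'rV[R]_6),
      y *m L xi = (p : 'rV[R]_6) *m L xi ->
      (u \o cinv c \o g) y = (u \o cinv c \o g) p.
    apply: filterS (filterI Ug Np) => y [[Uy cy] Ny] yp.
    rewrite /g /= !cmapK //; exact/(NL y p Ny (nbhs_singleton Np)).
  have line : (fun t : R => t *: w + (p : 'rV[R]_6)) @ (0 : R) --> (p : 'rV[R]_6).
    rewrite -[X in _ --> X]add0r -[X in X + _](scale0r w).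
    by apply: cvgD; [apply: cvgZr_tmp; exact: cvg_id | exact: cvg_cst].
  have near_line : \forall t \near (0 : R),
      (t *: w + p) *m L xi = (p : 'rV[R]_6) *m L xi ->
      (u \o cinv c \o g) (t *: w + p) = (u \o cinv c \o g) p := line _ cst_leaf.
  apply: filterS near_line => t; apply.
  by rewrite mulmxDl -scalemxAl wL scaler0 add0r.
split=> [[U1 [u [Fu U1q]]]|wL].
  by move/(ker _ _ Fu U1q).
have [U1 [u [Fu U1q]]] := (let: And3 _ b _ := Wfol xi in b) _ (VW _ Vq).
by exists U1, u; split=> //; apply/(ker _ _ Fu U1q).
Qed.

(** * The Segre cone of a 4-subweb *)

(** If [B] is a left inverse of [K], then [K *m B] is the identity modulo the
    kernel [T] of [K], on which [Om] vanishes; hence [G] is [B *m Om]. *)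
Lemma coframe_unique (R : realType) (T : set 'rV[R]_6) (K Om : 'M[R]_(6, 2)) :
  is_coframe T K -> is_coframe T Om ->
  exists2 G : 'M[R]_2, G \in unitmx & Om = K *m G.
Proof.
move=> [rK TK] [rOm TOm].
have /row_fullP[B BK] : row_full K by rewrite /row_full rK.
have OmE : Om = K *m (B *m Om).
  apply/eqP; rewrite -subr_eq0 -{1}[Om]mul1mx mulmxA -mulmxBl.
  apply/eqP/row_matrixP => i; rewrite row0 row_mul; apply/TOm/TK.
  by rewrite -row_mul mulmxBl mul1mx -mulmxA BK mulmx1 subrr row0.
exists (B *m Om) => //; rewrite -row_full_unit /row_full.
by rewrite eqn_leq rank_leq_col -{1}rOm {1}OmE mxrankM_maxr.
Qed.

(** A coframe [K] is normalized for the 4-subweb by multiplying [K (lo be)] by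
    [- D be].  Conversely, every normalized family is obtained from this one by
    a single change of basis [Ga] in the coframe of the foliation [a]: the three
    coframes [K (lo be)] are jointly independent, so the relation
    [- Oma = \sum_al Om al] can be compared with the one for [K a] term by
    term.  The invertible factor [Ga] does not affect the rank. *)
Lemma segre_coneE (R : realType) (W : preweb R) (a : 'I_6) c (p : wman W)
    (K : 'I_6 -> 'M[R]_(6, 2)) (D : 'I_3 -> 'M[R]_2) :
  (forall xi, is_coframe (tangent_plane (wfol W xi) c p) (K xi)) ->
  (forall w : 'I_3 -> 'rV[R]_2,
     exists v : 'rV[R]_6, forall be, v *m K (lo be) = w be) ->
  (forall be, D be \in unitmx) ->
  K a = \sum_be K (lo be) *m D be ->
  forall v, segre_cone a c p v <->
    (\rank (\matrix_(be < 3, i < 2) (v *m K (lo be) *m D be) ord0 i) <= 1)%N.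
Proof.
move=> cK surjK uD Ka v.
split=> [[Om [Oma [cOm cOma OmaE]]]|rM]; last first.
  exists (fun be => - (K (lo be) *m D be)), (K a); split=> //.
  - move=> be; have [rK TK] := cK (lo be); split.
      by rewrite mxrank_opp mxrankMfree ?rK // row_free_unit.
    move=> w; rewrite mulmxN mulmxA; split=> [/TK ->|].
      by rewrite mul0mx oppr0.
    move/eqP; rewrite oppr_eq0 => /eqP wK; apply/TK.
    by rewrite -(mulmxK (uD be) (w *m _)) wK mul0mx.
  - by rewrite sumrN Ka.
  - rewrite -mxrank_opp; congr (_ <= _)%N: rM; congr (\rank _).
    apply/matrixP => be i; rewrite mxE [RHS]mxE [in RHS]mxE.
    by rewrite mulmxN mulmxA [X in - X]mxE opprK.
have [Ga uGa OmaK] := coframe_unique (cK a) cOma.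
have /boolp.choice[H HE] : forall al, exists X, Om al = K (lo al) *m X.
  by move=> al; have [X _ ->] := coframe_unique (cK (lo al)) (cOm al); exists X.
have OmE be : Om be = - (K (lo be) *m D be *m Ga).
  have sum0 : \sum_al K (lo al) *m (H al + D al *m Ga) = 0.
    under eq_bigr do rewrite mulmxDr mulmxA.
    rewrite big_split /= -mulmx_suml -Ka -OmaK.
    by under eq_bigr do rewrite -HE; rewrite -OmaE addNr.
  suff HD : H be = - (D be *m Ga) by rewrite HE HD mulmxN mulmxA.
  apply/eqP; rewrite -addr_eq0; apply/eqP/row_matrixP => i.
  (* Multiplication by u selects the row i of the summand be. *)
  have [u uE] := surjK (fun al => if al == be then delta_mx 0 i else 0).
  have := congr1 (mulmx u) sum0; rewrite mulmx0 mulmx_sumr (bigD1 be) //= mulmxA uE eqxx.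
  rewrite big1 ?addr0 => [|al /negbTE alb]; last by rewrite mulmxA uE alb mul0mx.
  by rewrite -rowE row0.
set M := \matrix_(_, _) _.
suff -> : M = - ((\matrix_(be < 3, i < 2) (v *m K (lo be) *m D be) ord0 i) *m Ga).
  by rewrite mxrank_opp mxrankMfree // row_free_unit.
apply/matrixP => be i; rewrite /M [LHS]mxE OmE mulmxN !mulmxA [LHS]mxE [RHS]mxE.
by congr (- _); rewrite [LHS]mxE [RHS]mxE; apply: eq_bigr => k _; rewrite mxE.
Qed.

(** * The coordinates of W_A *)

(** The column xi of [xcoef A] holds the coefficients of x^xi in x^1, x^2, x^3,
    and the column xi of [ycoef A] those of y_xi in y_4, y_5, y_6. *)
Definition xcoef (T : pzRingType) (A : 'M[T]_3) : 'M[T]_(3, 6) := row_mx 1%:M A.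
Definition ycoef (T : pzRingType) (A : 'M[T]_3) : 'M[T]_(3, 6) := row_mx (- A^T) 1%:M.

Lemma xcoef_lo (T : pzRingType) (A : 'M[T]_3) be al :
  xcoef A be (lo al) = (be == al)%:R.
Proof. by rewrite [LHS](@row_mxEl T 3 3 3) mxE. Qed.

Lemma xcoef_hi (T : pzRingType) (A : 'M[T]_3) be al : xcoef A be (hi al) = A be al.
Proof. by rewrite [LHS](@row_mxEr T 3 3 3). Qed.

Lemma ycoef_lo (T : pzRingType) (A : 'M[T]_3) be al : ycoef A be (lo al) = - A al be.
Proof. by rewrite [LHS](@row_mxEl T 3 3 3) !mxE. Qed.

Lemma ycoef_hi (T : pzRingType) (A : 'M[T]_3) be al :
  ycoef A be (hi al) = (be == al)%:R.
Proof. by rewrite [LHS](@row_mxEr T 3 3 3) mxE. Qed.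

Definition integral_mx (T : pzRingType) (A : 'M[T]_3) (xi : 'I_6) : 'M[T]_(6, 2) :=
  block_mx (col xi (xcoef A)) 0 0 (col xi (ycoef A)) :> 'M[T]_(3 + 3, 1 + 1).

Lemma mul_integral_mx (T : pzRingType) (A : 'M[T]_3) xi (x y : 'rV[T]_3) :
  (row_mx x y : 'rV[T]_6) *m integral_mx A xi =
  row_mx (x *m col xi (xcoef A)) (y *m col xi (ycoef A)).
Proof.
apply: etrans (@mul_row_block T 1 3 3 1 1 x y _ _ _ _) _.
by rewrite !mulmx0 addr0 add0r.
Qed.

Lemma web_A_linear (R : realType) (A : 'M[R]_3) : web_A A = linear_web (integral_mx A).
Proof.
congr level_web; apply/funext => xi; apply/funext => p.
rewrite -[p](@hsubmxK _ 1 3 3) mul_integral_mx.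
move: (lsubmx _) (rsubmx _) => x y.
have Ex be : (row_mx x y : 'rV[R]_(3 + 3)) 0 (lo be) = x 0 be by rewrite row_mxEl.
have Ey be : (row_mx x y : 'rV[R]_(3 + 3)) 0 (hi be) = y 0 be by rewrite row_mxEr.
apply/rowP => i; rewrite mxE /xcoord /ycoord.
case: (@split_ordP 1 1 i) => j -> {i}; rewrite (ord1 j).
  rewrite (@row_mxEl _ 1 1 1) /= mxE; case: (@split_ordP 3 3 xi) => al ->.
    rewrite -/(lo al) Ex (bigD1 al) //= mxE xcoef_lo eqxx mulr1 big1 ?addr0 // => be bal.
    by rewrite mxE xcoef_lo (negbTE bal) mulr0.
  rewrite -/(hi al); apply: eq_bigr => be _.
  by rewrite Ex mulrC [X in _ = _ * X]mxE xcoef_hi.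
rewrite (@row_mxEr _ 1 1 1) /= mxE; case: (@split_ordP 3 3 xi) => al ->.
  rewrite -/(lo al) -sumrN; apply: eq_bigr => be _.
  by rewrite Ey mulrC [X in _ = _ * X]mxE ycoef_lo mulrN.
rewrite -/(hi al) Ey (bigD1 al) //= mxE ycoef_hi eqxx mulr1 big1 ?addr0 // => be bal.
by rewrite mxE ycoef_hi (negbTE bal) mulr0.
Qed.

Lemma integral_mx_x (T : pzRingType) (A : 'M[T]_3) xi (x y : 'rV[T]_3) :
  ((row_mx x y : 'rV[T]_6) *m integral_mx A xi) 0 0 = (x *m xcoef A) 0 xi.
Proof.
rewrite mul_integral_mx; have -> : (0 : 'I_2) = @lshift 1 1 0 by apply/val_inj.
by rewrite [LHS](@row_mxEl T 1 1 1) colE mulmxA -colE mxE.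
Qed.

Lemma integral_mx_y (T : pzRingType) (A : 'M[T]_3) xi (x y : 'rV[T]_3) :
  ((row_mx x y : 'rV[T]_6) *m integral_mx A xi) 0 1 = (y *m ycoef A) 0 xi.
Proof.
rewrite mul_integral_mx; have -> : (1 : 'I_2) = @rshift 1 1 0 by apply/val_inj.
by rewrite [LHS](@row_mxEr T 1 1 1) colE mulmxA -colE mxE.
Qed.

Lemma row6_eta (T : Type) (p : 'rV[T]_6) : exists x y : 'rV[T]_3, p = row_mx x y.
Proof. by exists (@lsubmx _ 1 3 3 p), (@rsubmx _ 1 3 3 p); rewrite [RHS]hsubmxK. Qed.

Lemma ord2_eta (i : 'I_2) : i = 0 \/ i = 1.
Proof. by case: i => -[|[|]] // lt2; [left|right]; apply/val_inj. Qed.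

Lemma row2P (T : Type) (u v : 'rV[T]_2) : u 0 0 = v 0 0 -> u 0 1 = v 0 1 -> u = v.
Proof. by move=> e0 e1; apply/rowP => i; case: (ord2_eta i) => ->. Qed.

(** The six functions x^be, y_be (be = 1, 2, 3) are linear coordinates, because
    y_1, y_2, y_3 are obtained from y_4, y_5, y_6 by the invertible matrix
    [- A]. *)
Lemma integral_mx_surj (F : fieldType) (A : 'M[F]_3) (w : 'I_3 -> 'rV[F]_2) :
  A \in unitmx -> exists v : 'rV[F]_6, forall be, v *m integral_mx A (lo be) = w be.
Proof.
move=> uA; pose y : 'rV[F]_3 := - ((\row_be w be 0 1) *m invmx A^T).
exists (row_mx (\row_be w be 0 0) y) => be; apply: row2P.
  rewrite integral_mx_x mxE (bigD1 be) //= big1 => [|k kb].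
    by rewrite xcoef_lo eqxx mulr1 addr0 mxE.
  by rewrite xcoef_lo (negbTE kb) mulr0.
rewrite integral_mx_y; transitivity ((y *m - A^T) 0 be).
  by rewrite !mxE; apply: eq_bigr => k _; rewrite ycoef_lo !mxE.
by rewrite mulmxN mulNmx opprK mulmxKV ?unitmx_tr // mxE.
Qed.

Definition minors_nonzero (F : fieldType) (A : 'M[F]_3) :=
  forall s : 'I_3 -> 'I_6, injective s ->
    \det (colsub s (xcoef A)) != 0 /\ \det (colsub s (ycoef A)) != 0.

Lemma row_mul_colsub_eq0 (F : fieldType) k n (X : 'M[F]_(k, n)) (s : 'I_k -> 'I_n)
    (x : 'rV[F]_k) :
  \det (colsub s X) != 0 -> (forall j, (x *m X) 0 (s j) = 0) -> x = 0.
Proof.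
move=> dX xX; have uX : colsub s X \in unitmx by rewrite unitmxE unitfE.
rewrite -[x](mulmxK uX) (_ : x *m _ = 0) ?mul0mx //.
apply/rowP => j; rewrite [RHS]mxE -(xX j) !mxE.
by apply: eq_bigr => i _; rewrite mxE.
Qed.

(** The intersection of the three planes splits into an x-part and a y-part,
    killed by a 3 x 3 submatrix of [xcoef A] and of [ycoef A] respectively. *)
Lemma integral_mx_general_position (F : fieldType) (A : 'M[F]_3) :
  minors_nonzero A -> in_general_position (integral_mx A).
Proof.
move=> mA xi eta ze xe xz ez.
pose s (j : 'I_3) := nth xi [:: xi; eta; ze] j.
have s_inj : injective s.
  move=> i j /eqP; rewrite nth_uniq //= ?inE ?negb_or ?xe ?xz ?ez //.
  by move=> /eqP/val_inj.
apply/eqP/inj_row_free => v; have [x [y ->]] := row6_eta v.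
rewrite !mul_mx_row -(row_mx0 _ 1 2 4) -(row_mx0 _ 1 2 2).
move=> /eq_row_mx[v1 /eq_row_mx[v2 v3]].
have [dX dY] := mA s s_inj.
have vs j : (row_mx x y : 'rV[F]_6) *m integral_mx A (s j) = 0.
  by case: j => -[|[|[|]]].
have -> : x = 0.
  by apply: row_mul_colsub_eq0 dX _ => j; rewrite -(integral_mx_x A (s j) x y) vs mxE.
have -> : y = 0.
  by apply: row_mul_colsub_eq0 dY _ => j; rewrite -(integral_mx_y A (s j) x y) vs mxE.
rewrite (row_mx0 F 1 2 2) (row_mx0 F 1 2 4); exact: (row_mx0 F 1 3 3).
Qed.

(** * The abelian equations of W_A *)

Lemma wedge_integral (R : realType) (A : 'M[R]_3) xi (x y x' y' : 'rV[R]_3) :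
  wedge (integral_mx A xi) (row_mx x y) (row_mx x' y') =
  (x *m xcoef A) 0 xi * (y' *m ycoef A) 0 xi -
  (x' *m xcoef A) 0 xi * (y *m ycoef A) 0 xi.
Proof. by rewrite /wedge !integral_mx_x !integral_mx_y. Qed.

Lemma sum6 (V : nmodType) (f : 'I_6 -> V) :
  \sum_xi f xi = \sum_al f (lo al) + \sum_al f (hi al).
Proof. exact: (@big_split_ord _ _ _ 3 3). Qed.

Lemma xcoef_ycoef (T : pzRingType) (A : 'M[T]_3) : xcoef A *m (ycoef A)^T = 0.
Proof.
rewrite /xcoef /ycoef (@tr_row_mx _ 3 3 3) (@mul_row_col _ 3 3 3).
by rewrite linearN /= trmxK trmx1 mul1mx mulmx1 addNr.
Qed.

(** The sum is the antisymmetrization of the bilinear form with matrix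
    [xcoef A *m (ycoef A)^T], which vanishes. *)
Lemma sum_wedge (R : realType) (A : 'M[R]_3) v w :
  \sum_xi wedge (integral_mx A xi) v w = 0.
Proof.
have [x [y ->]] := row6_eta v; have [x' [y' ->]] := row6_eta w.
have orth (z z' : 'rV[R]_3) : \sum_xi (z *m xcoef A) 0 xi * (z' *m ycoef A) 0 xi = 0.
  transitivity ((z *m xcoef A *m (z' *m ycoef A)^T) 0 0).
    by rewrite mxE; apply: eq_bigr => k _; rewrite [X in _ = _ * X]mxE.
  by rewrite trmx_mul mulmxA -(mulmxA z) xcoef_ycoef mulmx0 mul0mx mxE.
by under eq_bigr do rewrite wedge_integral; rewrite sumrB !orth subrr.
Qed.

Lemma wedge_integral_coef (R : realType) (A : 'M[R]_3) xi (i j : 'I_3) :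
  wedge (integral_mx A xi) (row_mx (delta_mx 0 i) (0 : 'rV[R]_3))
    (row_mx (0 : 'rV[R]_3) (delta_mx 0 j)) =
  xcoef A i xi * ycoef A j xi.
Proof. by rewrite wedge_integral -!rowE !mul0mx !mxE mulr0 subr0. Qed.

(** The 2-forms dx^i /\ dy_(3+j) are independent, and only the foliations i and
    3+j contribute to the coefficient of this one, with opposite coefficients
    [- A i j] and [A i j]. *)
Lemma relation_constant (R : realType) (A : 'M[R]_3) (g : 'I_6 -> R) :
  (forall i j, A i j != 0) ->
  (forall v w, \sum_xi g xi * wedge (integral_mx A xi) v w = 0) ->
  forall xi eta, g xi = g eta.
Proof.
move=> A0 rel.
have lohi i j : g (lo i) = g (hi j).
  have := rel (row_mx (delta_mx 0 i) (0 : 'rV[R]_3))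
    (row_mx (0 : 'rV[R]_3) (delta_mx 0 j)).
  under eq_bigr do rewrite wedge_integral_coef.
  rewrite sum6 (bigD1 i) //= [X in _ + X + _]big1 => [|k ki]; last first.
    by rewrite xcoef_lo eq_sym (negbTE ki) mul0r mulr0.
  rewrite (bigD1 j) //= [X in _ + (_ + X)]big1 => [|k kj]; last first.
    by rewrite ycoef_hi eq_sym (negbTE kj) !mulr0.
  rewrite xcoef_lo ycoef_lo xcoef_hi ycoef_hi !eqxx !addr0 mul1r mulr1 mulrN addrC.
  by move/eqP; rewrite subr_eq0 => /eqP/(mulIf (A0 i j)).
have all0 xi : g xi = g (hi 0).
  case: (@split_ordP 3 3 xi) => al ->; first exact: lohi.
  by rewrite -(lohi 0) -/(hi al) -(lohi 0).
by move=> xi eta; rewrite !all0.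
Qed.

(** By [relation_constant] the six functions of an abelian equation agree at
    each point.  Given [p], choose a point [q] with the same first integral as
    [p] for the foliation [lo 1] and with first integral 0 for [lo 0]: passing
    through these two foliations, the common value at [p] is the value at [q],
    which is that of the function of [lo 0] at 0.  Two constant families are
    then linearly dependent. *)
Lemma web_A_two_rank (R : realType) (A : 'M[R]_3) :
  A \in unitmx -> (forall i j, A i j != 0) -> maximum_two_rank (web_A A).
Proof.
move=> uA A0; rewrite web_A_linear.
pose u (xi : 'I_6) (x : euclidean R 6) := x *m integral_mx A xi.
exists u; split=> //.
- exists (fun _ _ _ => 1) => [k p c _ cp v w|a].
    under eq_bigr do rewrite mul1r (jac_linear _ cp).
    exact: sum_wedge.
  by move=> /(_ 0 0 I); rewrite big_ord1 mulr1 => a0 k; rewrite (ord1 k).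
move=> s [f fab find]; rewrite leqNgt; apply/negP => s1.
have fcst k xi p : f k xi (u xi p) = f k (lo 0) 0.
  have eqf q eta ze : f k eta (u eta q) = f k ze (u ze q).
    apply: (@relation_constant _ A (fun xi => f k xi (u xi q))) => // v w.
    have cq : @chart_at R 6 (euclidean R 6) q (euclidean_chart R 6) by split.
    have := fab k q (euclidean_chart R 6) I cq v w.
    by under eq_bigr do rewrite (jac_linear _ cq).
  have [q qE] := integral_mx_surj (fun al => if al == 0 then 0 else u (lo al) p) uA.
  rewrite (eqf p xi (lo 1)); have -> : u (lo 1) p = u (lo 1) q by rewrite [RHS]qE.
  by rewrite (eqf q (lo 1) (lo 0)); congr (f k _ _); exact: qE.
pose k0 := Ordinal (ltnW s1); pose k1 := Ordinal s1.
have k01 : k1 != k0 by [].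
have fk0 : f k0 (lo 0) 0 = 0.
  pose a k := if k == k0 then - f k1 (lo 0) 0 else if k == k1 then f k0 (lo 0) 0 else 0.
  suff a0 : a k1 = 0 by move: a0; rewrite /a (negbTE k01) eqxx.
  apply: find => xi p _; rewrite (bigD1 k0) //= (bigD1 k1) //= big1 => [|k]; last first.
    by case/andP=> /negbTE nk0 /negbTE nk1; rewrite /a nk0 nk1 mul0r.
  by rewrite /a !eqxx (negbTE k01) !fcst addr0 mulNr mulrC addNr.
suff /eqP : (k0 == k0)%:R = 0 :> R by rewrite eqxx oner_eq0.
apply: (find (fun k => (k == k0)%:R)) => xi p _.
by rewrite (bigD1 k0) //= big1 => [|k /negbTE->]; rewrite ?mul0r // fcst fk0 mulr0 addr0.
Qed.

(** * The Segre cones of W_A *)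

(** A matrix of rank at most 1 factors through a space of dimension at most 1. *)
Lemma rank1_minor (F : fieldType) m n (M : 'M[F]_(m, n)) i j k l :
  (\rank M <= 1)%N -> M i j * M k l = M i l * M k j.
Proof.
rewrite -{2 3 4 5}(mulmx_base M); move: (col_base M) (row_base M).
move: (\rank M) => [|[|//]] C D _; rewrite !mxE ?big_ord0 ?mul0r // !big_ord1; ring.
Qed.

(** The diagonal matrix that expresses the contribution of (x^be, y_be) to
    (x^(3+a), y_(3+a)). *)
Definition subweb_ratio (F : fieldType) (A : 'M[F]_3) (a be : 'I_3) : 'M[F]_2 :=
  diag_mx (\row_i (if i == 0 then A be a else - invmx A a be)).

(** The y-part is the relation y_(3+a) = - \sum_be b_a^be y_be, that is
    A^T *m (A^-1)^T = I. *)
Lemma integral_mx_hi (F : fieldType) (A : 'M[F]_3) a :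
  A \in unitmx ->
  integral_mx A (hi a) = \sum_be integral_mx A (lo be) *m subweb_ratio A a be.
Proof.
move=> uA; apply/row_matrixP => k; rewrite !rowE.
have [x [y ->]] := row6_eta (delta_mx 0 k : 'rV[F]_6).
rewrite mulmx_sumr; apply: row2P; rewrite summxE.
  rewrite integral_mx_x mxE; apply: eq_bigr => be _.
  rewrite mulmxA mul_mx_diag [RHS]mxE integral_mx_x xcoef_hi.
  congr (_ * _); last by rewrite mxE.
  rewrite mxE (bigD1 be) //= big1 => [|j jb]; first by rewrite xcoef_lo eqxx mulr1 addr0.
  by rewrite xcoef_lo (negbTE jb) mulr0.
transitivity ((y *m A^T *m (invmx A)^T) 0 a).
  rewrite -mulmxA -trmx_mul mulVmx // trmx1 mulmx1 integral_mx_y mxE.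
  rewrite (bigD1 a) //= big1 => [|j ja].
    by rewrite ycoef_hi eqxx mulr1 addr0.
  by rewrite ycoef_hi (negbTE ja) mulr0.
rewrite mxE; apply: eq_bigr => be _.
rewrite mulmxA mul_mx_diag [RHS]mxE integral_mx_y [X in _ = _ * X]mxE mulrN -mulNr.
congr (_ * _); last by rewrite mxE.
rewrite mxE [X in - X]mxE -sumrN; apply: eq_bigr => j _.
by rewrite ycoef_lo mxE mulrN opprK.
Qed.

(** The inequality says that the 2 x 2 minor, on the rows 0 and 1, of the matrix
    with rows (A be 1 / A be 0, B 1 be / B 0 be), where B is the inverse of A,
    does not vanish.  This matrix tests whether the vector with
    x^be = 1 / A be 0 and y_be = - 1 / B 0 be, which lies on the Segre cone of
    the first 4-subweb, also lies on that of the second. *)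
Lemma web_A_not_almost_grassmannizable (R : realType) (A : 'M[R]_3) :
  A \in unitmx -> in_general_position (integral_mx A) ->
  (forall i j, A i j != 0) -> (forall i j, invmx A i j != 0) ->
  A 0 1 * A 1 0 * (invmx A 1 1 * invmx A 0 0) !=
    A 1 1 * A 0 0 * (invmx A 1 0 * invmx A 0 1) ->
  ~ almost_grassmannizable (web_A A).
Proof.
rewrite web_A_linear => uA gpA A0 B0 /negP nQ [W [isW cones] eqvW]; apply: nQ.
have rL xi : \rank (integral_mx A xi) = 2%N := general_position_rank xi gpA.
have [q [c [J [Wq cq uJ TJ]]]] := equivalent_tangent rL isW eqvW.
(* The coframes of W are those of W_A transported by J. *)
pose K xi := invmx J *m integral_mx A xi.
have cK xi : is_coframe (tangent_plane (wfol W xi) c q) (K xi).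
  split.
    by rewrite eqmxMfull ?row_full_unit ?unitmx_inv // rL.
  by move=> v; rewrite mulmxA -TJ mulmxKV.
have surjK w : exists v : 'rV[R]_6, forall be, v *m K (lo be) = w be.
  have [v vw] := integral_mx_surj w uA; exists (v *m J) => be.
  by rewrite /K mulmxA mulmxK.
have uD a be : subweb_ratio A a be \in unitmx.
  rewrite unitmxE det_diag unitfE; apply/prodf_neq0 => i _.
  by rewrite mxE; case: ifP; rewrite ?oppr_eq0.
have Khi a : K (hi a) = \sum_be K (lo be) *m subweb_ratio A a be.
  by rewrite /K integral_mx_hi // mulmx_sumr; apply: eq_bigr => be _; rewrite mulmxA.
have coneE a v :=
  @segre_coneE _ W (hi a) c q K (subweb_ratio A a) cK surjK (uD a) (Khi a) v.
have [v vE] := surjK (fun be =>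
  \row_i (if i == 0 then (A be 0)^-1 else - (invmx A 0 be)^-1)).
pose M a : 'M[R]_(3, 2) :=
  \matrix_(be < 3, i < 2) (v *m K (lo be) *m subweb_ratio A a be) ord0 i.
have ME a be i :
    M a be i = if i == 0 then A be a / A be 0 else invmx A a be / invmx A 0 be.
  rewrite mxE vE mul_mx_diag !mxE; case: ifP => _; first by rewrite mulrC.
  by rewrite mulrNN mulrC.
have cone0 : segre_cone (hi 0) c q v.
  apply/coneE; rewrite -/(M 0).
  rewrite (_ : M 0 = (const_mx 1 : 'cV[R]_3) *m (const_mx 1 : 'rV[R]_2)).
    by apply: leq_trans (mxrankM_maxl _ _) (rank_leq_col _).
  apply/matrixP => be i; rewrite ME !mxE big_ord1 !mxE mulr1.
  by case: ifP => _; rewrite divff.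
have : segre_cone (hi 1) c q v by rewrite -(cones q c Wq cq 0 1).
move=> /coneE /(rank1_minor 0 0 1 1); rewrite -/(M 1) !ME /=.
move: (A0 0 0) (A0 1 0) (B0 0 0) (B0 0 1); move: (invmx A) => B a00 a10 b00 b01.
move/(congr1 ( *%R^~ (A 0 0 * A 1 0 * B 0 0 * B 0 1))) => minor.
apply/eqP; transitivity (A 0 1 / A 0 0 * (B 1 1 / B 0 1) *
    (A 0 0 * A 1 0 * B 0 0 * B 0 1)); first by field; rewrite a00 b01.
by rewrite minor; field; rewrite b00 a10.
Qed.

(** * The genericity polynomial *)

(** The first factor ensures general position, the second one that the matrices
    [subweb_ratio] are invertible and that [relation_constant] applies, the
    third one that the first two Segre cones differ.  The adjugate replaces
    the inverse so that the expression is a polynomial. *)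
Definition genericity (T : comPzRingType) (A : 'M[T]_3) : T :=
  (\prod_(s : {ffun 'I_3 -> 'I_6} | injectiveb s)
     (\det (colsub s (xcoef A)) * \det (colsub s (ycoef A)))) *
  (\prod_i \prod_j (A i j * \adj A i j)) *
  (A 0 1 * A 1 0 * (\adj A 1 1 * \adj A 0 0) -
   A 1 1 * A 0 0 * (\adj A 1 0 * \adj A 0 1)).

(** This serves twice: evaluation of polynomials turns the expression for the
    generic matrix into its value at [A], and the embedding of the integers
    transports the nonvanishing at [witness] to the reals. *)
Lemma genericity_morph (T T' : comNzRingType) (f : {rmorphism T -> T'}) (A : 'M[T]_3) :
  f (genericity A) = genericity (map_mx f A).
Proof.
have adjE i j : f (\adj A i j) = \adj (map_mx f A) i j by rewrite -map_mx_adj [RHS]mxE.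
have mapE i j : f (A i j) = map_mx f A i j by rewrite mxE.
have xE : map_mx f (xcoef A) = xcoef (map_mx f A).
  by rewrite /xcoef (@map_row_mx _ _ _ 3 3 3) map_mx1.
have yE : map_mx f (ycoef A) = ycoef (map_mx f A).
  by rewrite /ycoef (@map_row_mx _ _ _ 3 3 3) map_mxN map_trmx map_mx1.
rewrite /genericity !rmorphM rmorphB !rmorphM /= !adjE !mapE !rmorph_prod.
congr (_ * _ * _).
  by apply: eq_bigr => s _; rewrite rmorphM /= -!det_map_mx !map_mxsub xE yE.
apply: eq_bigr => i _; rewrite rmorph_prod; apply: eq_bigr => j _.
by rewrite rmorphM /= adjE mapE.
Qed.

Lemma det_matrix2 (T : comPzRingType) (F : nat -> nat -> T) :
  \det (\matrix_(i < 2, j < 2) F i j) = F 0%N 0%N * F 1%N 1%N - F 0%N 1%N * F 1%N 0%N.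
Proof.
rewrite (expand_det_row _ 0) !big_ord_recl big_ord0 addr0 /cofactor !det_mx11 !mxE /=.
by rewrite /bump /= expr0 expr1; ring.
Qed.

(** Matrices given by functions of natural numbers make the entries of
    submatrices computable; this is the expansion along the first row. *)
Definition det3 (T : pzRingType) (F : nat -> nat -> T) : T :=
  F 0%N 0%N * (F 1%N 1%N * F 2%N 2%N - F 1%N 2%N * F 2%N 1%N) -
  F 0%N 1%N * (F 1%N 0%N * F 2%N 2%N - F 1%N 2%N * F 2%N 0%N) +
  F 0%N 2%N * (F 1%N 0%N * F 2%N 1%N - F 1%N 1%N * F 2%N 0%N).

Lemma minor_matrix (T : comPzRingType) m (F : nat -> nat -> T) (i0 j0 : 'I_m.+1) :
  row' i0 (col' j0 (\matrix_(i < m.+1, j < m.+1) F i j)) =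
  \matrix_(i < m, j < m) F (bump i0 i) (bump j0 j).
Proof. by apply/matrixP => i j; rewrite !mxE. Qed.

Lemma det_matrix3 (T : comPzRingType) (F : nat -> nat -> T) :
  \det (\matrix_(i < 3, j < 3) F i j) = det3 F.
Proof.
rewrite (expand_det_row _ 0) !big_ord_recl big_ord0 addr0 /cofactor.
rewrite !(minor_matrix F) !(det_matrix2 (fun i j => F (bump _ i) (bump _ j))) !mxE /=.
by rewrite /det3 /bump /= expr0 expr1; ring.
Qed.

Definition entry (t : seq (seq int)) (i j : nat) : int := nth 0 (nth [::] t i) j.

Definition witness : 'M[int]_3 :=
  \matrix_(i, j) entry [:: [:: 1; 1; 1]; [:: 1; 2; 4]; [:: 1; 3; 9]] i j.

Lemma xcoef_witness : xcoef witness = \matrix_(i < 3, k < 6) entry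
  [:: [:: 1; 0; 0; 1; 1; 1]; [:: 0; 1; 0; 1; 2; 4]; [:: 0; 0; 1; 1; 3; 9]] i k.
Proof.
apply/matrixP => i k; rewrite [RHS]mxE; case: (@split_ordP 3 3 k) => al ->.
  by rewrite -/(lo al) xcoef_lo; case: i => -[|[|[|]]] // ?; case: al => -[|[|[|]]].
by rewrite -/(hi al) xcoef_hi mxE; case: i => -[|[|[|]]] // ?; case: al => -[|[|[|]]].
Qed.

Lemma ycoef_witness : ycoef witness = \matrix_(i < 3, k < 6) entry
  [:: [:: -1; -1; -1; 1; 0; 0]; [:: -1; -2; -3; 0; 1; 0]; [:: -1; -4; -9; 0; 0; 1]] i k.
Proof.
apply/matrixP => i k; rewrite [RHS]mxE; case: (@split_ordP 3 3 k) => al ->.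
  by rewrite -/(lo al) ycoef_lo mxE; case: i => -[|[|[|]]] // ?; case: al => -[|[|[|]]].
by rewrite -/(hi al) ycoef_hi; case: i => -[|[|[|]]] // ?; case: al => -[|[|[|]]].
Qed.

Lemma adj_witness : \adj witness = \matrix_(i, j) entry
  [:: [:: 6; -6; 2]; [:: -5; 8; -3]; [:: 1; -2; 1]] i j.
Proof.
apply/matrixP => i j; rewrite mxE /cofactor /witness.
rewrite (minor_matrix (entry _)) (det_matrix2 (fun i j => entry _ (bump _ i) (bump _ j))).
by rewrite mxE; case: i => -[|[|[|]]] // ?; case: j => -[|[|[|]]].
Qed.

Definition minors_check (t : seq (seq int)) : bool :=
  all (fun a => all (fun b => all (fun c =>
    uniq [:: a; b; c] ==> (det3 (fun i j => entry t i (nth 0%N [:: a; b; c] j)) != 0))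
    (iota 0 6)) (iota 0 6)) (iota 0 6).

Lemma minors_checkP t (s : 'I_3 -> 'I_6) : minors_check t -> injective s ->
  \det (colsub s (\matrix_(i < 3, k < 6) entry t i k)) != 0.
Proof.
move=> ct s_inj.
have sE (j : 'I_3) : nth 0%N [:: val (s 0); val (s 1); val (s 2)] j = s j.
  by case: j => -[|[|[|]]] // lt3; congr (val (s _)); apply/val_inj.
have -> : colsub s (\matrix_(i < 3, k < 6) entry t i k) =
    \matrix_(i < 3, j < 3) entry t i (nth 0%N [:: val (s 0); val (s 1); val (s 2)] j).
  by apply/matrixP => i j; rewrite !mxE sE.
rewrite (det_matrix3 (fun i j =>
  entry t i (nth 0%N [:: val (s 0); val (s 1); val (s 2)] j))).
have s6 j : val (s j) \in iota 0 6 by rewrite mem_iota add0n ltn_ord.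
have /allP/(_ _ (s6 0))/allP/(_ _ (s6 1))/allP/(_ _ (s6 2))/implyP := ct; apply.
by rewrite /= !inE !(inj_eq val_inj) !(inj_eq s_inj).
Qed.

Lemma genericity_witness : genericity witness != 0.
Proof.
rewrite /genericity xcoef_witness ycoef_witness adj_witness !mulf_neq0 //.
- apply/prodf_neq0 => s /injectiveP s_inj.
  by rewrite mulf_neq0 // minors_checkP //; vm_compute.
- apply/prodf_neq0 => i _; apply/prodf_neq0 => j _; rewrite !mxE.
  by case: i => -[|[|[|]]] // ?; case: j => -[|[|[|]]].
- by rewrite !mxE.
Qed.

(** The inverse is the adjugate divided by the determinant, and the last
    inequality is homogeneous of degree 2 in the inverse. *)
Lemma genericityP (F : fieldType) (A : 'M[F]_3) :
  A \in unitmx -> genericity A != 0 ->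
  [/\ minors_nonzero A, forall i j, A i j != 0, forall i j, invmx A i j != 0
    & A 0 1 * A 1 0 * (invmx A 1 1 * invmx A 0 0) !=
        A 1 1 * A 0 0 * (invmx A 1 0 * invmx A 0 1)].
Proof.
move=> uA; rewrite /genericity !mulf_eq0 !negb_or -andbA.
move=> /and3P[minors entries cones].
have d0 : \det A != 0 by rewrite -unitfE -unitmxE.
have BE i j : invmx A i j = (\det A)^-1 * \adj A i j by rewrite /invmx uA mxE.
have entryP i j : (A i j != 0) && (\adj A i j != 0).
  move/prodf_neq0: entries => /(_ i isT)/prodf_neq0/(_ j isT).
  by rewrite mulf_eq0 negb_or.
split=> [s s_inj|i j|i j|].
- move/prodf_neq0: minors => /(_ (finfun s)); rewrite mulf_eq0 negb_or.
  have sE n (X : 'M[F]_(3, n)) (r : 'I_3 -> 'I_n) : colsub (finfun r) X = colsub r X.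
    by apply/matrixP => i j; rewrite !mxE ffunE.
  rewrite !sE => /(_ _)/andP; apply; apply/injectiveP => i j.
  by rewrite !ffunE => /s_inj.
- by have /andP[] := entryP i j.
- by rewrite BE mulf_neq0 ?invr_neq0 //; have /andP[] := entryP i j.
- rewrite !BE -subr_eq0; apply: contraNneq cones => e0.
  have /eqP : (\det A)^-1 ^+ 2 * (A 0 1 * A 1 0 * (\adj A 1 1 * \adj A 0 0) -
      A 1 1 * A 0 0 * (\adj A 1 0 * \adj A 0 1)) = 0 by rewrite -e0; ring.
  by rewrite mulf_eq0 expf_eq0 /= invr_eq0 (negbTE d0).
Qed.

Theorem corollary3 (R : realType) :
  exists P : mpoly.mpoly (3 * 3) R,
    P <> 0 /\
    forall A : 'M[R]_3, A \in unitmx ->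
      mpoly.meval (fun k : 'I_(3 * 3) => mxvec A 0 k) P <> 0 ->
      [/\ is_web (web_A A),
          parallelizable (web_A A),
          ~ almost_grassmannizable (web_A A)
        & maximum_two_rank (web_A A)].
Proof.
pose X : 'M[mpoly.mpoly (3 * 3) R]_3 :=
  \matrix_(i, j) mpoly.mpolyX R (mpoly.mnm1 (mxvec_index i j)).
have evalX (A : 'M[R]_3) :
    mpoly.meval (fun k => mxvec A 0 k) (genericity X) = genericity A.
  rewrite genericity_morph; congr genericity; apply/matrixP => i j.
  by rewrite mxE [X i j]mxE; apply: etrans (mpoly.mevalXU _ _) _; exact: mxvecE.
exists (genericity X); split=> [X0|A uA].
  have /eqP := evalX (map_mx intr witness).
  rewrite X0 mpoly.meval0 -(genericity_morph (intmul 1)) eq_sym intr_eq0.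
  by rewrite (negbTE genericity_witness).
rewrite evalX => /eqP/(genericityP uA)[minors A0 B0 cones].
have gpA := integral_mx_general_position minors; split.
- by rewrite web_A_linear; exact: linear_web_is_web.
- by rewrite web_A_linear; exact: linear_web_parallelizable.
- exact: web_A_not_almost_grassmannizable.
- exact: web_A_two_rank.
Qed.
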